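(* Let $n\ge 3$ and let $M^n$ be an $n$-dimensional complete, connected, smooth Riemannian manifold without boundary, with metric $\langle\,,\rangle$, and suppose $M^n$ is isometric to a Riemannian product $N\times\mathbb{R}$. Let $f:M^n\to\mathbb{R}$ be a non-trivial affine function, and let $\alpha:I\subset\mathbb{R}\to M^n$ be a Frenet curve of proper $n$ with harmonic curvature functions $\{H_1^*,\dots,H_{n-2}^*\}$. If $\alpha$ is an $f$-eikonal $V_n$-slant helix curve, then $H_{n-2}^*\neq 0$ and $(H_1^* )^2+(H_2^* )^2+\dots+(H_{n-2}^* )^2$ is a non-zero constant.
   Context: A smooth curve $\alpha=\alpha(s):I\to M^n$ ($I\subset\mathbb{R}$ an interval), parametrized by arc length, is a Frenet curve of proper $n$ if there are orthonormal frame fields $\{V_1=\alpha',V_2,\dots,V_n\}$ along $\alpha$ (the Frenet frame) and positive functions $k_1(s),\dots,k_{n-1}(s)$ (the curvatures) with $$\nabla_{\alpha'}V_i=-k_{i-1}V_{i-1}+k_iV_{i+1},\qquad i=1,\dots,n,$$ where $V_0=V_{n+1}=0$ and $\nabla_{\alpha'}$ is the Riemannian (Levi-Civita) connection along $\alpha$. Harmonic curvature functions $H_i^*:I\to\mathbb{R}$ of $\alpha$ (in terms of $V_n$): $$H_0^*=0,\qquad H_1^*=\frac{k_{n-1}}{k_{n-2}},\qquad H_i^*=\frac{1}{k_{n-(i+1)}}\left\{k_{n-i}H_{i-2}^*-(H_{i-1}^* )'\right\}\quad(2\le i\le n-2),$$ where $'=d/ds$. $\nabla f$ is the gradient of the function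 $f$: $df(X)=\langle\nabla f,X\rangle$. A Frenet curve $\alpha$ is an $f$-eikonal $V_n$-slant helix curve, with axis $\nabla f$, if $\|\nabla f\|$ is constant along $\alpha$ and the function $\langle\nabla f,V_n\rangle$ is a non-zero constant along $\alpha$. A function $f:M^n\to\mathbb{R}$ is affine if for every geodesic $\gamma$ of $M^n$ (with affine parameter $t$) the function $t\mapsto f(\gamma(t))$ is of the form $at+b$ with $a,b$ real constants; it is non-trivial if it is not constant. *)

(* Defs.v *)
From HB Require Import structures.
From mathcomp Require Import all_boot all_order all_algebra.
From mathcomp Require Import all_classical all_reals all_analysis.

Set Implicit Arguments.
Unset Strict Implicit.
Unset Printing Implicit Defensive.
Import Order.TTheory GRing.Theory Num.Theory.
Import numFieldNormedType.Exports.
Local Open Scope classical_set_scope.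
Local Open Scope ring_scope.

Section Smooth.
Variables (R : realType) (V W : normedModType R).

(* For U open in a finite-dimensional V this is the usual class C^k: it is
   equivalent to ask for all iterated directional derivatives or only for the
   iterated partial derivatives in a basis. *)
Fixpoint Ck (k : nat) (U : set V) (f : V -> W) : Prop :=
  (forall x, U x -> {for x, continuous f}) /\
  if k is k'.+1 then
    forall v, (forall x, U x -> derivable f x v) /\ Ck k' U ('D_v f)
  else True.

Definition smooth_at (f : V -> W) (x : V) : Prop :=
  exists2 U, open_nbhs x U & forall k, Ck k U f.

End Smooth.

Section Manifolds.
Variable R : realType.

(* [cmap] and [cinv] are total functions, only meaningful on [cdom] and on
   [cmap @` cdom] respectively. *)
Record chart (T : topologicalType) (n : nat) := Chart {
  cdom : set T;
  cmap : T -> 'rV[R]_n;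
  cinv : 'rV[R]_n -> T }.

Definition is_chart T n (c : chart T n) : Prop :=
  [/\ open (cdom c), open (cmap c @` cdom c),
      forall p, cdom c p -> cinv c (cmap c p) = p,
      forall p, cdom c p -> {for p, continuous (cmap c)} &
      forall x, (cmap c @` cdom c) x -> {for x, continuous (cinv c)}].

(* The atlas is {chart_at p | p in M}. The tangent space at p is 'rV[R]_n, a
   row vector being the list of components of a tangent vector in the chart
   [chart_at p]; [metric p] is the Gram matrix of the scalar product at p in
   these components. *)
Record metricData (n : nat) := MetricData {
  carrier :> topologicalType;
  chart_at : carrier -> chart carrier n;
  metric : carrier -> 'M[R]_n }.

Section Basic.
Variables (n : nat) (M : metricData n).

Definition coord (p q : M) : 'rV[R]_n := cmap (chart_at p) q.
Definition point_of (p : M) (x : 'rV[R]_n) : M := cinv (chart_at p) x.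

Definition transition (p q : M) (x : 'rV[R]_n) : 'rV[R]_n :=
  coord q (point_of p x).

(* vectors are rows, so a tangent vector with components u at x in the chart
   of p has components u *m change p q x in the chart of q *)
Definition change (p q : M) (x : 'rV[R]_n) : 'M[R]_n :=
  jacobian (transition p q) x.

Definition inner (p : M) (u v : 'rV[R]_n) : R := (u *m metric p *m v^T) 0 0.
Definition tnorm (p : M) (u : 'rV[R]_n) : R := Num.sqrt (inner p u u).

(* the matrix (g_ij) of the metric at x in the chart of p *)
Definition gram (p : M) (x : 'rV[R]_n) : 'M[R]_n :=
  let q := point_of p x in
  change p q x *m metric q *m (change p q x)^T.

(* Gamma^k_ij at x in the chart of p, for the Levi-Civita connection *)
Definition christoffel (p : M) (x : 'rV[R]_n) (k i j : 'I_n) : R :=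
  let dg (l a b : 'I_n) := 'D_(delta_mx 0 l) (fun y => gram p y a b) x in
  2^-1 * \sum_(l < n) invmx (gram p x) k l * (dg i j l + dg j i l - dg l i j).

Definition is_riemannian : Prop :=
  [/\ hausdorff_space M /\ @second_countable M,
      forall p : M, is_chart (chart_at p) /\ cdom (chart_at p) p,
      forall (p q r : M), cdom (chart_at p) r -> cdom (chart_at q) r ->
        smooth_at (transition p q) (coord p r),
      forall p : M, (metric p)^T = metric p /\
        (forall u, u != 0 -> 0 < inner p u u) &
      forall p r : M, cdom (chart_at p) r -> smooth_at (gram p) (coord p r)].

End Basic.

Record riemannianManifold (n : nat) := RiemannianManifold {
  rdata :> metricData n;
  rdataP : is_riemannian rdata }.

Definition prod_chart (S T : topologicalType) (m n : nat)
    (c : chart S m) (d : chart T n) : chart (S * T)%type (m + n) :=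
  Chart (cdom c `*` cdom d)
        (fun z => row_mx (cmap c z.1) (cmap d z.2))
        (fun x => (cinv c (lsubmx x), cinv d (rsubmx x))).

Definition riem_prod (m n : nat) (M : metricData m) (N : metricData n) :
    metricData (m + n) :=
  @MetricData (m + n) (M * N)%type
    (fun z => prod_chart (chart_at z.1) (chart_at z.2))
    (fun z => block_mx (metric z.1) 0 0 (metric z.2)).

Definition real_line : metricData 1 :=
  @MetricData 1 R (fun=> Chart setT (fun t => t%:M) (fun x => x 0 0))
    (fun=> 1%:M).

Section Maps.
Variables (m n : nat) (M : metricData m) (N : metricData n).

Definition local_rep (F : M -> N) (p : M) (x : 'rV[R]_m) : 'rV[R]_n :=
  coord (F p) (F (point_of p x)).

Definition smooth_map (F : M -> N) : Prop :=
  forall p, {for p, continuous F} /\ smooth_at (local_rep F p) (coord p p).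

Definition tangent_map (F : M -> N) (p : M) (u : 'rV[R]_m) : 'rV[R]_n :=
  u *m jacobian (local_rep F p) (coord p p).

End Maps.

Definition isometric (m n : nat) (M : metricData m) (N : metricData n) : Prop :=
  exists (F : M -> N) (G : N -> M),
    [/\ cancel F G, cancel G F, smooth_map F, smooth_map G &
        forall p u v,
          inner (F p) (tangent_map F p u) (tangent_map F p v) = inner p u v].

Section Curves.
Variables (n : nat) (M : metricData n).

(* Curves are total functions R -> M; a curve on an interval I which is not
   open is smooth on I when it extends smoothly to a neighbourhood of I, and
   this is what smoothness at every point of I expresses. The values outside
   the neighbourhood are irrelevant. *)
Definition smooth_curve_at (al : R -> M) (s : R) : Prop :=
  {for s, continuous al} /\ smooth_at (fun t => coord (al s) (al t)) s.

Definition velocity (al : R -> M) (s : R) : 'rV[R]_n :=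
  derive1 (fun t => coord (al s) (al t)) s.

(* A vector field along al is a function V with V t in the tangent space at
   al t; these are its components in the fixed chart of al s. *)
Definition field_rep (al : R -> M) (V : R -> 'rV[R]_n) (s t : R) : 'rV[R]_n :=
  V t *m change (al t) (al s) (coord (al t) (al t)).

Definition smooth_field_at (al : R -> M) (V : R -> 'rV[R]_n) (s : R) : Prop :=
  smooth_at (field_rep al V s) s.

(* the covariant derivative of V along al for the Levi-Civita connection *)
Definition covD (al : R -> M) (V : R -> 'rV[R]_n) (s : R) : 'rV[R]_n :=
  derive1 (field_rep al V s) s +
  \row_k \sum_(i < n) \sum_(j < n)
    christoffel (al s) (coord (al s) (al s)) k i j
      * velocity al s 0 i * V s 0 j.

Definition geodesic (J : set R) (ga : R -> M) : Prop :=
  forall t, J t -> smooth_curve_at ga t /\ covD ga (velocity ga) t = 0.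

(* every geodesic can be extended to R, i.e. exp_p is defined on the whole
   tangent space at p for every p *)
Definition complete_riem : Prop :=
  forall (p : M) (v : 'rV[R]_n),
    exists ga : R -> M, [/\ geodesic setT ga, ga 0 = p & velocity ga 0 = v].

Definition smooth_fun (f : M -> R) : Prop :=
  forall p, smooth_at (fun x => f (point_of p x)) (coord p p).

Definition dfun (f : M -> R) (p : M) (X : 'rV[R]_n) : R :=
  'D_X (fun x => f (point_of p x)) (coord p p).

Definition grad (f : M -> R) (p : M) : 'rV[R]_n :=
  get [set G | forall X, dfun f p X = inner p G X].

Definition affine_fun (f : M -> R) : Prop :=
  forall (J : set R) (ga : R -> M), is_interval J -> geodesic J ga ->
    exists a b : R, forall t, J t -> f (ga t) = a * t + b.

Definition nontrivial_fun (f : M -> R) : Prop :=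
  ~ exists c, forall p, f p = c.

(* Only V 1, ..., V n and k 1, ..., k n.-1 carry information. Arc length
   parametrization is contained in V_1 = al' and inner V_1 V_1 = 1. *)
Definition frenet_curve (I : set R) (al : R -> M)
    (V : nat -> R -> 'rV[R]_n) (k : nat -> R -> R) : Prop :=
  V 0%N = (fun=> 0) /\ V n.+1 = (fun=> 0) /\
  forall s, I s ->
    [/\ smooth_curve_at al s,
        V 1%N s = velocity al s,
        forall i, (1 <= i <= n)%N -> smooth_field_at al (V i) s,
        forall i, (1 <= i <= n.-1)%N -> smooth_at (k i) s /\ 0 < k i s &
        (forall i j, (1 <= i <= n)%N -> (1 <= j <= n)%N ->
          inner (al s) (V i s) (V j s) = (i == j)%:R) /\
        (forall i, (1 <= i <= n)%N ->
          covD al (V i) s =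
            - k i.-1 s *: V i.-1 s + k i s *: V i.+1 s)].

Definition eikonal_Vn_slant (f : M -> R) (I : set R) (al : R -> M)
    (V : nat -> R -> 'rV[R]_n) : Prop :=
  (exists c, forall s, I s -> tnorm (al s) (grad f (al s)) = c) /\
  (exists2 c, c != 0 &
     forall s, I s -> inner (al s) (grad f (al s)) (V n s) = c).

End Curves.

Fixpoint Hstar (n : nat) (k : nat -> R -> R) (i : nat) {struct i} : R -> R :=
  match i with
  | 0 => fun=> 0
  | i1.+1 =>
    match i1 with
    | 0 => fun s => k (n - 1)%N s / k (n - 2)%N s
    | i2.+1 => fun s =>
        (k (n - i)%N s * Hstar n k i2 s - derive1 (Hstar n k i1) s)
          / k (n - i.+1)%N s
    end
  end.

End Manifolds.

(* Main.v *)
From HB Require Import structures.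
From mathcomp Require Import all_boot all_order all_algebra.
From mathcomp Require Import all_classical all_reals all_analysis.
From mathcomp Require Import ring lra zify.
(* after the algebra library, whose coordinate function of a basis is also
   called coord *)
Require Import Defs.

Set Implicit Arguments.
Unset Strict Implicit.
Unset Printing Implicit Defensive.
Import Order.TTheory GRing.Theory Num.Theory.
Import numFieldNormedType.Exports.
Local Open Scope classical_set_scope.
Local Open Scope ring_scope.

(** Write c_i = df(V_i) = <grad f, V_i> along the curve.  The whole proof rests
    on the fact that grad f is parallel: differentiating c_i along the curve
    then only differentiates V_i, so the c_i satisfy the Frenet equations
    c_i' = - k_{i-1} c_{i-1} + k_i c_{i+1}.

    That grad f is parallel means that the Hessian of f vanishes.  For a
    geodesic ga the second derivative of f (ga t) is Hess f (ga', ga'), and it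
    is zero because f is affine; by completeness every tangent vector v is the
    velocity of a geodesic, so Hess f (v, v) = 0 for all v.  The Hessian is
    symmetric, by Schwarz's theorem and the symmetry of the Christoffel symbols,
    and polarization gives Hess f = 0 ([affine_hessian0]).  The value
    df(V) along a curve has derivative df(DV/ds) + Hess f (al', V)
    ([derive_dfun_along]), which holds for any smooth f by the chain rule.  All
    this needs two classical facts on functions of several variables that are
    C^k in the sense of iterated directional derivatives: C^1 functions are
    differentiable ([C1_differentiable]) and second derivatives commute
    ([derive_swap]).

    By the slant condition c_n is a nonzero constant a.  Solving the Frenet
    equations downwards from c_n = a, c_{n+1} = 0 gives c_{n-1} = 0, and then
    the recursion that defines the harmonic curvatures: c_{n-1-i} = a H_i
    ([coef_Hstar]).  As V_1, ..., V_n is an orthonormal basis,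
    |grad f|^2 = sum_i c_i^2 = a^2 (1 + sum_i H_i^2), so sum_i H_i^2 is
    constant, and it is positive because H_1 = k_{n-1} / k_{n-2} is.  Finally
    c_1 = a H_{n-2}; were it identically zero, solving the same equations
    upwards would give c_2 = 0, ..., c_n = 0 ([Hstar_last_neq0]). *)

(** * Derivatives along lines *)

Section Line.
Variable R : realType.
Variables V V' W : normedModType R.

(** A directional derivative only sees the values on one line. *)
Lemma eq_along_line (f : V -> W) (g : V' -> W) a v b w :
  (forall h : R, f (h *: v + a) = g (h *: w + b)) ->
  (derivable f a v -> derivable g b w) /\ 'D_v f a = 'D_w g b.
Proof.
move=> fg; have fa : f a = g b by have := fg 0; rewrite !scale0r !add0r.
have E : (fun h : R => h^-1 *: ((f \o shift a) (h *: v) - f a)) =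
         (fun h : R => h^-1 *: ((g \o shift b) (h *: w) - g b)).
  by apply/funext => h /=; rewrite fg fa.
by rewrite /derivable /derive E.
Qed.

End Line.

Section LineTranslate.
Variables (R : realType) (V W : normedModType R).

Let translate (f : V -> W) (c x v : V) :
  (derivable f (x + c) v -> derivable (fun y => f (y + c)) x v) /\
  'D_v f (x + c) = 'D_v (fun y => f (y + c)) x.
Proof. by apply: eq_along_line => h; rewrite addrA. Qed.

Lemma derivable_translate (f : V -> W) (c x v : V) :
  derivable f (x + c) v -> derivable (fun y => f (y + c)) x v.
Proof. exact: (translate f c x v).1. Qed.

Lemma derive_translate (f : V -> W) (c x v : V) :
  'D_v (fun y => f (y + c)) x = 'D_v f (x + c).
Proof. by rewrite (translate f c x v).2. Qed.

Lemma is_derive_line (f : V -> W) (x v : V) (t : R) :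
  derivable f (x + t *: v) v ->
  is_derive t (1 : R) (fun a => f (x + a *: v)) ('D_v f (x + t *: v)).
Proof.
have [d1 d2] := @eq_along_line R V R W f (fun a : R => f (x + a *: v))
  (x + t *: v) v t 1
  (fun h => ltac:(by rewrite /= scalerDl [h *: 1]mulr1 addrCA)).
by move=> /d1 ?; split.
Qed.

End LineTranslate.

(** The point [xi] lies between 0 and [c]; bounding its absolute value covers both
    signs of [c] at once, and [partials_increment] takes steps of either sign. *)
Lemma line_mean_value (R : realType) (V : normedModType R) (f : V -> R)
    (x v : V) (c : R) :
  (forall t, `|t| <= `|c| -> derivable f (x + t *: v) v) ->
  exists2 xi, `|xi| <= `|c| &
    f (x + c *: v) - f x = c * 'D_v f (x + xi *: v).
Proof.
move=> df; pose g (a : R) := f (x + a *: v).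
have dg t : `|t| <= `|c| -> is_derive t (1 : R) g ('D_v f (x + t *: v)).
  by move=> /df; exact: is_derive_line.
have g0 : g 0 = f x by rewrite /g scale0r addr0.
rewrite -[f (x + c *: v)]/(g c) -g0.
have [c0|c0] := leP 0 c.
  have H t : t \in `[0, c] -> `|t| <= `|c|.
    by rewrite in_itv/= => /andP[t0 tc]; rewrite !ger0_norm.
  have [||xi xiP ->] := @MVT_segment R g (fun t => 'D_v f (x + t *: v)) 0 c c0.
  - by move=> t /subset_itv_oo_cc /H; exact: dg.
  - by apply: derivable_within_continuous => t /H /dg[].
  - by exists xi; [exact: H|rewrite subr0 mulrC].
have H t : t \in `[c, 0] -> `|t| <= `|c|.
  rewrite in_itv/= => /andP[t0 tc].
  by rewrite !ler0_norm ?lerN2// ltW.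
have [||xi xiP E] := @MVT_segment R g (fun t => 'D_v f (x + t *: v)) c 0 (ltW c0).
- by move=> t /subset_itv_oo_cc /H; exact: dg.
- by apply: derivable_within_continuous => t /H /dg[].
- exists xi; first exact: H.
  by rewrite -opprB E sub0r mulrN opprK mulrC.
Qed.

(** * Functions of class C^k *)

Lemma near_eq_continuous (T U : topologicalType) (f g : T -> U) (x : T) :
  (\forall y \near x, f y = g y) -> {for x, continuous f} ->
  {for x, continuous g}.
Proof.
move=> fg cf; have cf' : f @ x --> g x.
  by rewrite -(nbhs_singleton fg); exact: cf.
apply: cvg_trans cf'; apply: near_eq_cvg; exact: fg.
Qed.

Section CkBasics.
Variables (R : realType) (V W : normedModType R).

Lemma Ck_continuous k (U : set V) (f : V -> W) x :
  Ck k U f -> U x -> {for x, continuous f}.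
Proof. by case: k => [|k] [h _]; exact: h. Qed.

Lemma Ck_derivable k (U : set V) (f : V -> W) x v :
  Ck k.+1 U f -> U x -> derivable f x v.
Proof. by case=> _ /(_ v)[h _]; exact: h. Qed.

Lemma Ck_derive k (U : set V) (f : V -> W) v : Ck k.+1 U f -> Ck k U ('D_v f).
Proof. by case=> _ /(_ v)[]. Qed.

Lemma Ck_sub k (U U' : set V) (f : V -> W) : U' `<=` U -> Ck k U f -> Ck k U' f.
Proof.
move=> sU; elim: k f => [|k IH] f [cf df]; first by split=> // x /sU; auto.
split=> [x /sU|v]; first by auto.
by have [d1 d2] := df v; split=> [x /sU|]; auto.
Qed.

Lemma CkW k (U : set V) (f : V -> W) : Ck k.+1 U f -> Ck k U f.
Proof.
elim: k f => [|k IH] f [cf df]; split=> // v.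
by have [d1 d2] := df v; split=> //; exact: IH.
Qed.

(** The class only depends on the values in [U] because [U] is open. *)
Lemma Ck_ext k (U : set V) (f g : V -> W) : open U ->
  (forall x, U x -> f x = g x) -> Ck k U f -> Ck k U g.
Proof.
move=> oU; have nU x : U x -> \forall y \near x, U y.
  by move=> Ux; apply: open_nbhs_nbhs.
elim: k f g => [|k IH] f g fg [cf df].
  split=> // x Ux.
  by apply: near_eq_continuous (cf _ Ux); apply: filterS (nU _ Ux) => y /fg.
split=> [x Ux|v].
  by apply: near_eq_continuous (cf _ Ux); apply: filterS (nU _ Ux) => y /fg.
have [d1 d2] := df v; split=> [x Ux|].
  apply: near_eq_derivable (d1 _ Ux).
  by apply: filterS (nU _ Ux) => y /fg.
apply: IH d2 => x Ux; apply: near_eq_derive.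
by apply: filterS (nU _ Ux) => y /fg.
Qed.

End CkBasics.

Section CkAlgebra.
Variables (R : realType) (V : normedModType R).
Implicit Types (U : set V) (f g : V -> R).

Lemma CkD k U f g : open U -> Ck k U f -> Ck k U g ->
  Ck k U (fun x => f x + g x).
Proof.
move=> oU; elim: k f g => [|k IH] f g [cf df] [cg dg].
  by split=> // x Ux; apply: cvgD; [exact: cf|exact: cg].
split=> [x Ux|v]; first by apply: cvgD; [exact: cf|exact: cg].
have [f1 f2] := df v; have [g1 g2] := dg v; split=> [x Ux|].
  by apply: derivableD; auto.
apply: Ck_ext (IH _ _ f2 g2) => // x Ux.
by rewrite [RHS]deriveD; auto.
Qed.

(** Induction on [k]: the derivative of the product is given by the Leibniz rule
    on [U], and both terms are of class C^k by induction. *)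
Lemma CkM k U f g : open U -> Ck k U f -> Ck k U g ->
  Ck k U (fun x => f x * g x).
Proof.
move=> oU; elim: k f g => [|k IH] f g.
  by move=> [cf df] [cg dg]; split=> // x Ux; apply: cvgM; [exact: cf|exact: cg].
move=> Cf Cg; have Cf' := CkW Cf; have Cg' := CkW Cg.
case: Cf Cg => [cf df] [cg dg].
split=> [x Ux|v]; first by apply: cvgM; [exact: cf|exact: cg].
have [f1 f2] := df v; have [g1 g2] := dg v; split=> [x Ux|].
  by apply: derivableM; auto.
apply: Ck_ext (CkD oU (IH _ _ Cf' g2) (IH _ _ Cg' f2)) => // x Ux.
by rewrite [RHS]deriveM; auto.
Qed.

Lemma Ck_cst k U (c : R) : Ck k U (fun=> c).
Proof.
elim: k c => [|k IH] c; first by split=> // x _; exact: cvg_cst.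
split=> [x _|v]; first exact: cvg_cst.
split=> [x _|]; first exact: derivable_cst.
suff -> : 'D_v (fun=> c) = (fun=> 0 : R) :> (V -> R) by exact: IH.
by apply/funext => x; exact: derive_cst.
Qed.

Lemma CkV k U f : open U -> (forall x, U x -> f x != 0) -> Ck k U f ->
  Ck k U (fun x => (f x)^-1).
Proof.
move=> oU f0; elim: k => [|k IH].
  by move=> [cf _]; split=> // x Ux; apply: cvgV; [exact: f0|exact: cf].
move=> Cf; have Ci := IH (CkW Cf).
case: Cf => cf df; split=> [x Ux|v].
  by apply: cvgV; [exact: f0|exact: cf].
have [f1 f2] := df v; split=> [x Ux|].
  by apply: derivableV; auto.
apply: Ck_ext (CkM oU (Ck_cst k U (-1)) (CkM oU (CkM oU Ci Ci) f2)) => // x Ux.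
rewrite [RHS]deriveV; auto.
by rewrite mulN1r scaleNr -exprVn expr2.
Qed.

Lemma smooth_atD f g x : smooth_at f x -> smooth_at g x ->
  smooth_at (fun x => f x + g x) x.
Proof.
move=> [U Ux Uf] [U' U'x U'g]; exists (U `&` U'); first exact: open_nbhsI.
move=> k; apply: CkD; first exact: openI Ux.1 U'x.1.
  by apply: Ck_sub (Uf k); exact: subIsetl.
by apply: Ck_sub (U'g k); exact: subIsetr.
Qed.

Lemma smooth_atM f g x : smooth_at f x -> smooth_at g x ->
  smooth_at (fun x => f x * g x) x.
Proof.
move=> [U Ux Uf] [U' U'x U'g]; exists (U `&` U'); first exact: open_nbhsI.
move=> k; apply: CkM; first exact: openI Ux.1 U'x.1.
  by apply: Ck_sub (Uf k); exact: subIsetl.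
by apply: Ck_sub (U'g k); exact: subIsetr.
Qed.

Lemma smooth_at_cst (c : R) (x : V) : smooth_at (fun _ : V => c) x.
Proof.
exists setT; first by split=> //; exact: openT.
by move=> k; exact: Ck_cst.
Qed.

Lemma smooth_atV f x : f x != 0 -> smooth_at f x ->
  smooth_at (fun x => (f x)^-1) x.
Proof.
move=> fx0 [U [oU Ux] Uf].
have : nbhs x (U `&` [set y | f y != 0]).
  apply: filterI; first exact: open_nbhs_nbhs.
  have /(_ _ Ux) cf := (Uf 0%N).1.
  have := cvgr_neq0 (f x) cf fx0; exact.
move=> /nbhs_interior; set U' := _^°; exists U'.
  split; first exact: open_interior.
  exact: nbhs_singleton.
move=> k; apply: CkV; first exact: open_interior.
  by move=> y /interior_subset[].
by apply: Ck_sub (Uf k) => y /interior_subset[].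
Qed.

End CkAlgebra.

Lemma smooth_atB (R : realType) (V : normedModType R) (f g : V -> R) x :
  smooth_at f x -> smooth_at g x -> smooth_at (fun x => f x - g x) x.
Proof.
move=> sf sg.
have -> : (fun x => f x - g x) = (fun x => f x + -1 * g x).
  by apply/funext => y; rewrite mulN1r.
by apply: smooth_atD => //; apply: smooth_atM => //; exact: smooth_at_cst.
Qed.

Lemma smooth_at_derive (R : realType) (V W : normedModType R) (f : V -> W) x v :
  smooth_at f x -> smooth_at ('D_v f) x.
Proof. by move=> [U Ux Uf]; exists U => // k; exact: Ck_derive (Uf k.+1). Qed.

Lemma smooth_at_derivable (R : realType) (V W : normedModType R)
    (f : V -> W) x v : smooth_at f x -> derivable f x v.
Proof. by move=> [U [_ Ux] Uf]; exact: Ck_derivable (Uf 1%N) Ux. Qed.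

(** * Differentiability of C^1 functions *)

Lemma row_norm_le (R : realType) n (u : 'rV[R]_n) (C : R) : 0 <= C ->
  (forall j, `|u 0 j| <= C) -> `|u| <= C.
Proof.
move=> C0 uC; rewrite /Num.Def.normr/= mx_normrE (bigmax_le _ C0)//= => -[i j] _.
by rewrite ord1 uC.
Qed.

Lemma entry_le_row_norm (R : realType) n (u : 'rV[R]_n) j : `|u 0 j| <= `|u|.
Proof.
rewrite [leRHS]/Num.Def.normr/= mx_normrE.
exact: (le_bigmax _ (fun i : 'I_1 * 'I_n => `|u i.1 i.2|) (0, j)).
Qed.

Section PartialsDifferentiable.
Variables (R : realType) (n : nat).
Implicit Types (U : set 'rV[R]_n) (phi : 'rV[R]_n -> R) (x : 'rV[R]_n).

Let e (j : 'I_n) : 'rV[R]_n := delta_mx 0 j.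

Definition partials phi x : 'cV[R]_n := \col_j 'D_(e j) phi x.

(** The linear form on row vectors with coefficients [c]; applied to the partial
    derivatives of a function it is its differential. *)
Definition covector (c : 'cV[R]_n) (u : 'rV[R]_n) : R := (u *m c) 0 0.

Fact covector_is_linear c : linear (covector c : 'rV[R]_n -> R^o).
Proof. by move=> a u v; rewrite /covector mulmxDl -scalemxAl !mxE. Qed.

HB.instance Definition _ c := GRing.isLinear.Build R 'rV[R]_n R^o _
  (covector c : 'rV[R]_n -> R^o) (covector_is_linear c).

Lemma covectorD c u v : covector c (u + v) = covector c u + covector c v.
Proof. by rewrite /covector mulmxDl mxE. Qed.

Lemma covectorZ c a u : covector c (a *: u) = a * covector c u.
Proof. by rewrite /covector -scalemxAl mxE. Qed.

Lemma covectorE c u : covector c u = \sum_j u 0 j * c j 0.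
Proof. by rewrite /covector mxE. Qed.

Lemma covector_delta c j : covector c (e j) = c j 0.
Proof. by rewrite /covector -rowE mxE. Qed.

Lemma covector_continuous c : continuous (covector c : 'rV[R]_n -> R).
Proof.
move=> u; apply: differentiable_continuous.
have -> : covector c = \sum_j (fun u : 'rV[R]_n => u 0 j * c j 0).
  by apply/funext => v; rewrite covectorE fct_sumE.
apply: differentiable_sum => j; apply: differentiableM => //.
exact: differentiable_coord.
Qed.

(** The increment from [x] to [x + h] is split into [n] steps parallel to the
    axes.  The mean value theorem turns the [j]-th step into [h 0 j] times a value
    of the [j]-th partial derivative near [x], which differs from its value at
    [x] by at most [eps / (n + 1)]; the sum of the [n] errors is at most
    [eps * `|h|]. *)
Lemma partials_increment U phi x (eps : R) : open U -> U x -> Ck 1 U phi ->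
  0 < eps -> \forall h \near (0 : 'rV[R]_n),
    `|phi (h + x) - phi x - covector (partials phi x) h| <= eps * `|h|.
Proof.
move=> oU Ux Cphi eps0; pose eps' := eps / n.+1%:R.
have eps'0 : 0 < eps' by rewrite divr_gt0.
have : \forall y \near x, U y /\
    forall j, `|'D_(e j) phi y - 'D_(e j) phi x| <= eps'.
  have near_j (j : 'I_n) : \forall y \near x,
      `|'D_(e j) phi y - 'D_(e j) phi x| <= eps'.
    have /cvgr_distC_le := Ck_continuous (Ck_derive (e j) Cphi) Ux.
    by apply.
  have near_U : \forall y \near x, U y by exact: open_nbhs_nbhs.
  have near_all := filter_forall (nbhs_filter x) near_j.
  by apply: filterS2 near_U near_all => y Uy hy; split.
move=> /nbhs_ballP[d /= d0 near_x].
apply/nbhs_ballP; exists d => //= h; rewrite -ball_normE/= sub0r normrN => hd.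
(* p k has the first k coordinates of h: it is the end point of the k-th step *)
pose p k : 'rV[R]_n := \row_j (if (j < k)%N then h 0 j else 0).
have p_n : p n = h by apply/rowP => j; rewrite mxE ltn_ord.
suff bound k : (k <= n)%N ->
    `|phi (p k + x) - phi x - covector (partials phi x) (p k)|
      <= k%:R * (eps' * `|h|).
  rewrite -{1 2}p_n (le_trans (bound n _))//.
  rewrite mulrA ler_wpM2r// /eps' mulrCA ger_pMr// ler_pdivrMr// mul1r.
  by rewrite ler_nat.
elim: k => [_|k IH kn].
  have -> : p 0%N = 0 by apply/rowP => j; rewrite !mxE.
  by rewrite add0r subrr covectorE big1 ?subr0 ?normr0 ?mul0r// => j; rewrite mxE mul0r.
pose j := Ordinal kn.
have pS : p k.+1 = p k + h 0 j *: e j.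
  apply/rowP => i; rewrite !mxE/= ltnS leq_eqVlt -(inj_eq val_inj)/=.
  have [ij|ij] /= := eqVneq (val i) k; last by rewrite mulr0 addr0.
  by rewrite ij ltnn add0r mulr1; congr (h 0 _); apply: val_inj.
have inb t : `|t| <= `|h 0 j| -> ball x d (p k + x + t *: e j).
  move=> th; rewrite -ball_normE/= distrC addrAC addrK (le_lt_trans _ hd)//.
  apply: row_norm_le => // i; rewrite !mxE/= -(inj_eq val_inj)/=.
  have [ij|ij] := eqVneq (val i) k.
    by rewrite ij ltnn add0r mulr1 (le_trans th)// entry_le_row_norm.
  by rewrite mulr0 addr0; case: ifP; rewrite ?normr0// entry_le_row_norm.
have [t th|xi xij E] := @line_mean_value R _ phi (p k + x) (e j) (h 0 j).
  by have [Ut _] := near_x _ (inb t th); exact: Ck_derivable Cphi Ut.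
have -> : phi (p k.+1 + x) - phi x - covector (partials phi x) (p k.+1) =
   (phi (p k + x) - phi x - covector (partials phi x) (p k)) +
   h 0 j * ('D_(e j) phi (p k + x + xi *: e j) - 'D_(e j) phi x).
  rewrite mulrBr -E pS covectorD covectorZ.
  rewrite covector_delta [partials _ _ _ _]mxE (addrAC (p k)).
  by ring.
rewrite -natr1 mulrDl mul1r (le_trans (ler_normD _ _))// lerD//.
  by apply: IH; exact: ltnW.
rewrite normrM mulrC ler_pM// ?entry_le_row_norm//.
by have [_ ] := near_x _ (inb xi xij); exact.
Qed.

Lemma C1_differentiable_fun U phi x : open U -> U x -> Ck 1 U phi ->
  differentiable phi x /\ forall u, 'D_u phi x = covector (partials phi x) u.
Proof.
move=> oU Ux Cphi.
have dphi : 'd phi x = covector (partials phi x) :> (_ -> _).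
  apply: diff_unique; first exact: covector_continuous.
  apply/eqaddoP => eps eps0; have := partials_increment oU Ux Cphi eps0.
  apply: filterS => h; rewrite opprD addrA; exact.
have dp : differentiable phi x.
  apply/diff_locallyP; rewrite dphi; split; first exact: covector_continuous.
  apply/eqaddoP => eps eps0; have := partials_increment oU Ux Cphi eps0.
  apply: filterS => h; rewrite opprD addrA; exact.
by split=> // u; rewrite deriveE// dphi.
Qed.

End PartialsDifferentiable.

Section Coordinates.
Variables (R : realType) (V : normedModType R) (m : nat).

Lemma derivable_entry (F : V -> 'rV[R]_m) x v j : derivable F x v ->
  derivable (fun y => F y 0 j) x v /\ 'D_v (fun y => F y 0 j) x = 'D_v F x 0 j.
Proof.
move=> dF; split; first by have /derivable_mxP := dF; exact.
by rewrite (derive_mx dF) mxE.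
Qed.

Lemma continuous_entry (F : V -> 'rV[R]_m) x j :
  {for x, continuous F} -> {for x, continuous (fun y => F y 0 j)}.
Proof.
move=> cF; apply: (@continuous_comp _ _ _ F (fun M : 'rV[R]_m => M 0 j)) => //.
exact: coord_continuous.
Qed.

Lemma Ck_entry k (U : set V) (F : V -> 'rV[R]_m) j : open U ->
  Ck k U F -> Ck k U (fun y => F y 0 j).
Proof.
move=> oU; elim: k F => [|k IH] F [cF dF].
  by split=> // x Ux; apply/continuous_entry/cF.
split=> [x Ux|v]; first by apply/continuous_entry/cF.
have [d1 d2] := dF v; split=> [x Ux|].
  by have [] := derivable_entry j (d1 x Ux).
by apply: Ck_ext (IH _ d2) => // x Ux; have [_ ->] := derivable_entry j (d1 x Ux).
Qed.

End Coordinates.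

Lemma C1_differentiable (R : realType) n m (U : set 'rV[R]_n)
    (F : 'rV[R]_n -> 'rV[R]_m) x :
  open U -> U x -> Ck 1 U F -> differentiable F x.
Proof.
move=> oU Ux CF.
have -> : F = \sum_j (fun y => F y 0 j *: (delta_mx 0 j : 'rV[R]_m)).
  by apply/funext => y; rewrite fct_sumE [LHS]row_sum_delta.
apply: differentiable_sum => j; apply: differentiableZl.
by have [] := C1_differentiable_fun oU Ux (Ck_entry j oU CF).
Qed.

(** * The second derivative *)

Lemma derive_comp (R : realType) (V V' W : normedModType R) (g : V -> V')
    (f : V' -> W) x v :
  differentiable g x -> differentiable f (g x) ->
  'D_v (f \o g) x = 'D_('D_v g x) f (g x).
Proof.
move=> dg df; rewrite !deriveE//; first by rewrite diff_comp.
exact: differentiable_comp.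
Qed.

Section Schwarz.
Variables (R : realType) (V : normedModType R).

(** The mean value theorem twice: first for the increment of [f] by [c w], in the
    direction [v], then for ['D_v f] in the direction [w]. *)
Lemma second_increment (U : set V) (f : V -> R) x v w c : Ck 2 U f ->
  (forall a b : R, `|a| <= `|c| -> `|b| <= `|c| -> U (x + a *: v + b *: w)) ->
  exists a b, [/\ `|a| <= `|c|, `|b| <= `|c| &
    f (x + c *: v + c *: w) - f (x + c *: v) - f (x + c *: w) + f x =
    c * (c * 'D_w ('D_v f) (x + a *: v + b *: w))].
Proof.
move=> Cf Uab; have Cf1 := CkW Cf.
have U0 a : `|a| <= `|c| -> U (x + a *: v).
  by move=> ac; have := Uab a 0 ac; rewrite scale0r addr0 normr0; exact.
have dshift (a : R) : `|a| <= `|c| ->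
    derivable (fun y => f (y + c *: w)) (x + a *: v) v.
  by move=> ac; apply: derivable_translate; apply: Ck_derivable Cf1 (Uab _ _ ac _).
have [a ac|a ac Ea] :=
    @line_mean_value R V (fun y => f (y + c *: w) - f y) x v c.
  by apply: derivableB; [exact: dshift|exact: Ck_derivable Cf1 (U0 _ ac)].
have [b bc|b bc Eb] := @line_mean_value R V ('D_v f) (x + a *: v) w c.
  exact: Ck_derivable (Ck_derive v Cf) (Uab _ _ ac bc).
exists a, b; split=> //; rewrite -Eb.
rewrite deriveB ?derive_translate in Ea; last 2 first.
- exact: dshift.
- exact: Ck_derivable Cf1 (U0 _ ac).
by rewrite -Ea; ring.
Qed.

Let dist_le (g : V -> R) x eps : {for x, continuous g} -> 0 < eps ->
  \forall y \near x, `|g x - g y| <= eps.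
Proof. by move=> /cvgr_dist_le cg; exact: cg. Qed.

(** The second increment of [f] is symmetric in [v] and [w]; up to the factor
    [c ^ 2] it is a value near [x] of one mixed derivative, and also of the
    other, and both are continuous at [x]. *)
Lemma derive_swap (U : set V) (f : V -> R) x v w : open U -> U x -> Ck 2 U f ->
  'D_v ('D_w f) x = 'D_w ('D_v f) x.
Proof.
move=> oU Ux Cf; apply/eqP; rewrite -subr_eq0 -normr_le0.
suff small (eps : R) : 0 < eps -> `|'D_v ('D_w f) x - 'D_w ('D_v f) x| <= eps.
  by apply/ler_addgt0Pr => eps eps0; rewrite add0r small.
move=> eps0; have e2 : 0 < eps / 2 by rewrite divr_gt0.
have near_vw : \forall y \near x, U y /\
    (`|'D_v ('D_w f) x - 'D_v ('D_w f) y| <= eps / 2 /\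
     `|'D_w ('D_v f) x - 'D_w ('D_v f) y| <= eps / 2).
  apply: filterI; first exact: open_nbhs_nbhs.
  have c1 := Ck_continuous (Ck_derive v (Ck_derive w Cf)) Ux.
  have c2 := Ck_continuous (Ck_derive w (Ck_derive v Cf)) Ux.
  by apply: filterI; [exact: dist_le c1 e2|exact: dist_le c2 e2].
have /nbhs_ballP[d /= d0 near_x] := near_vw.
(* the parallelogram of sides c v and c w stays in the ball of radius d *)
pose c := d / 2 / (1 + `|v| + `|w|).
have c0 : 0 < c by rewrite !divr_gt0// !ltr_wpDr.
have inb a b : `|a| <= `|c| -> `|b| <= `|c| -> ball x d (x + a *: v + b *: w).
  rewrite (gtr0_norm c0) => ac bc.
  rewrite -ball_normE/= -addrA opprD addNKr normrN.
  rewrite (le_lt_trans (ler_normD _ _))// !normrZ.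
  apply: (@le_lt_trans _ _ (c * (1 + `|v| + `|w|))).
    by rewrite !mulrDr mulr1 -addrA (ler_wpDl (ltW c0))// lerD// ler_wpM2r.
  rewrite divfK; last by rewrite gt_eqF// !ltr_wpDr.
  by rewrite ltr_pdivrMr// ltr_pMr// ltr1n.
have [|a [b [ac bc E1]]] := @second_increment U f x v w c Cf.
  by move=> a b ac bc; have [] := near_x _ (inb _ _ ac bc).
have [|b' [a' [bc' ac' E2]]] := @second_increment U f x w v c Cf.
  move=> b' a' bc' ac'; rewrite addrAC.
  by have [] := near_x _ (inb _ _ ac' bc').
have [_ [+ _]] := near_x _ (inb _ _ ac' bc'); rewrite addrAC => n1.
have [_ [_ n2]] := near_x _ (inb _ _ ac bc).
have E : 'D_w ('D_v f) (x + a *: v + b *: w) =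
         'D_v ('D_w f) (x + b' *: w + a' *: v).
  apply: (mulfI (lt0r_neq0 c0)); apply: (mulfI (lt0r_neq0 c0)).
  apply: etrans (esym E1) (etrans _ E2).
  by rewrite [x + c *: w + _]addrAC [in RHS](addrAC (f _)).
rewrite E in n2; rewrite (splitr eps); apply: le_trans (lerD n1 n2).
rewrite [X in _ <= _ + X]distrC; apply: le_trans (ler_normD _ _).
by rewrite addrA subrK.
Qed.

End Schwarz.

(** Identities between functions on [I] can be differentiated at every point of
    [I], end points included, although the derivatives are two-sided. *)
Lemma derive_eq_on_interval (R : realType) (I : set R) (f g : R -> R) (s : R) :
  is_interval I -> (exists a b : R, [/\ I a, I b & a < b]) -> I s ->
  derivable f s 1 -> derivable g s 1 -> (forall t, I t -> f t = g t) ->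
  'D_1 f s = 'D_1 g s.
Proof.
move=> itvI [a [b [Ia Ib ab]]] Is df dg fg.
apply/eqP; rewrite -subr_eq0 -deriveB//; apply/negPn/negP => l0.
have dh : derivable (f - g) s 1 by exact: derivableB.
set l := 'D_1 _ s in l0.
have /cvgrPdist_lt/(_ `|l|) : (fun h : R => h^-1 *:
    (((f - g) \o shift s) (h *: 1) - (f - g) s)) @ 0^' --> l by exact: dh.
rewrite normr_gt0 => /(_ l0) /= /nbhs_ballP[d /= d0 near_s].
have [c Ic cs] : exists2 c, I c & c != s.
  have [as_|as_] := eqVneq a s; last by exists a.
  by exists b => //; rewrite -as_ gt_eqF.
have [h h0 [hd Ih]] : exists2 h, h != 0 & `|h| < d /\ I (h + s).
  have cs0 : 0 < `|c - s| by rewrite normr_gt0 subr_eq0.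
  (* move from s towards c, but by less than d *)
  pose tau := Num.min 1 (d / 2 / `|c - s|).
  have tau0 : 0 < tau by rewrite lt_min ltr01 !divr_gt0.
  have tau1 : tau <= 1 by rewrite ge_min lexx.
  exists (tau * (c - s)); first by rewrite mulf_neq0 ?subr_eq0// gt_eqF.
  split.
    rewrite normrM gtr0_norm// -ltr_pdivlMr//.
    rewrite (@le_lt_trans _ _ (d / 2 / `|c - s|))//; first by rewrite ge_min lexx orbT.
    by rewrite ltr_pM2r ?invr_gt0// gtr_pMr// invf_lt1// ltr1n.
  have [sc|sc] := leP s c.
    apply: (itvI s c) => //; apply/andP; split; nra.
  by apply: (itvI c s) => //; apply/andP; split; nra.
have := near_s h; rewrite /= -ball_normE/= sub0r normrN => /(_ hd h0).
have E : (f - g) (h *: 1 + s) = 0.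
  by rewrite [h *: 1]mulr1 -[LHS]/(f _ - g _) fg ?subrr.
have E0 : (f - g) s = 0 by rewrite -[LHS]/(f _ - g _) fg ?subrr.
by rewrite E E0 subrr scaler0 subr0 ltxx.
Qed.

Section SecondDerivative.
Variables (R : realType) (n : nat).

Definition second_partials (phi : 'rV[R]_n -> R) x : 'M[R]_n :=
  \matrix_(i, j) 'D_(delta_mx 0 i) ('D_(delta_mx 0 j) phi) x.

(** The product rule for [sum_j W_j (d_j phi \o ga)]. *)
Lemma derive_partials_along (U : set 'rV[R]_n) phi (ga W : R -> 'rV[R]_n) s :
  open U -> U (ga s) -> Ck 2 U phi -> derivable ga s 1 -> derivable W s 1 ->
  let c t := covector (partials phi (ga t)) (W t) in
  derivable c s 1 /\
  'D_1 c s = covector (partials phi (ga s)) ('D_1 W s) +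
    ('D_1 ga s *m second_partials phi (ga s) *m (W s)^T) 0 0.
Proof.
move=> oU Us Cphi dga dW c.
have cE : c = \sum_j (fun t => W t 0 j * ('D_(delta_mx 0 j) phi \o ga) t).
  apply/funext => t; rewrite /c covectorE fct_sumE.
  by apply: eq_bigr => j _; rewrite mxE.
have /derivable1_diffP dga' := dga.
have dphi j := C1_differentiable_fun oU Us (Ck_derive (delta_mx 0 j) Cphi).
have dpg j : derivable ('D_(delta_mx 0 j) phi \o ga) s 1.
  by apply: diff_derivable; apply: differentiable_comp => //; exact: (dphi j).1.
have dWj j := derivable_entry j dW.
have dt j : derivable (fun t => W t 0 j * ('D_(delta_mx 0 j) phi \o ga) t) s 1.
  by apply: derivableM => //; exact: (dWj j).1.
rewrite cE; split; first exact: derivable_sum.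
rewrite derive_sum// covectorE [X in _ + X]mxE -big_split/=.
apply: eq_bigr => j _; rewrite (deriveM (dWj j).1 (dpg j)).
rewrite (dWj j).2 (derive_comp _ dga' (dphi j).1).
rewrite (dphi j).2 addrC [partials phi _ _ _]mxE [_^T _ _]mxE.
rewrite ![_ *: _]/(_ * _) mulrC [X in _ + X]mulrC; congr (_ + _).
apply: (congr1 (fun z => W s 0 j * z)); rewrite covectorE mxE; apply: eq_bigr => i _.
by rewrite !mxE.
Qed.

End SecondDerivative.

(** * Changes of charts *)

Section ChartChange.
Variables (R : realType) (n : nat) (M : riemannianManifold R n).
Implicit Types (p q : M) (f : M -> R).

Lemma chart_atP p : is_chart (chart_at p).
Proof. by have [_ h _ _ _] := rdataP M; have [] := h p. Qed.

Lemma in_chart_at p : cdom (chart_at p) p.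
Proof. by have [_ h _ _ _] := rdataP M; have [] := h p. Qed.

Lemma coordK p q : cdom (chart_at p) q -> point_of p (coord p q) = q.
Proof. by have [_ _ h _ _] := chart_atP p; exact: h. Qed.

Lemma near_cdom p q : cdom (chart_at p) q ->
  \forall r \near q, cdom (chart_at p) r.
Proof.
by have [op _ _ _ _] := chart_atP p; move=> pq; exact: open_nbhs_nbhs.
Qed.

Lemma coord_continuous_at p q : cdom (chart_at p) q ->
  {for q, continuous (coord p)}.
Proof. by have [_ _ _ h _] := chart_atP p; exact: h. Qed.

Lemma point_of_continuous_at p q : cdom (chart_at p) q ->
  {for coord p q, continuous (point_of p)}.
Proof. by have [_ _ _ _ h] := chart_atP p; move=> pq; apply: h; exists q. Qed.

Lemma near_point_of p q r : cdom (chart_at q) r -> cdom (chart_at p) r ->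
  \forall x \near coord q r, cdom (chart_at p) (point_of q x).
Proof.
move=> qr pr; have := point_of_continuous_at qr; apply.
by rewrite /= coordK//; exact: near_cdom.
Qed.

Lemma near_coordK p : \forall x \near coord p p, coord p (point_of p x) = x.
Proof.
have [_ op h _ _] := chart_atP p.
have : \forall x \near coord p p, (cmap (chart_at p) @` cdom (chart_at p)) x.
  by apply: open_nbhs_nbhs; split=> //; exists p => //; exact: in_chart_at.
by apply: filterS => _ [q pq <-]; rewrite /coord /point_of h.
Qed.

Lemma transition_differentiable p q r :
  cdom (chart_at p) r -> cdom (chart_at q) r ->
  differentiable (transition p q) (coord p r).
Proof.
have [_ _ h _ _] := rdataP M => pr qr.
by have [U [oU Ur] CU] := h _ _ _ pr qr; exact: C1_differentiable (CU 1%N).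
Qed.

Lemma change_refl p (u : 'rV[R]_n) : u *m change p p (coord p p) = u.
Proof.
have pp := in_chart_at p; rewrite /change -deriveEjacobian; last first.
  exact: transition_differentiable.
rewrite -[RHS](@derive_id R _ (coord p p)).
exact: near_eq_derive (near_coordK p).
Qed.

(** [dfun] is defined in the chart at [q]; the chain rule for the transition map
    computes it in any other chart around [q]. *)
Lemma dfun_change f p q X : cdom (chart_at p) q ->
  differentiable (f \o point_of p) (coord p q) ->
  dfun f q X =
    'D_(X *m change q p (coord q q)) (f \o point_of p) (coord p q).
Proof.
move=> pq df; have qq := in_chart_at q.
have dt := transition_differentiable qq pq.
have tq : transition q p (coord q q) = coord p q by rewrite /transition coordK.
rewrite /dfun /change -(deriveEjacobian _ dt) -tq -derive_comp ?tq//.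
apply: near_eq_derive; have := near_point_of qq pq; apply: filterS => x px.
by rewrite /= /transition coordK.
Qed.

Lemma field_rep_refl (al : R -> M) (W : R -> 'rV[R]_n) s :
  field_rep al W s s = W s.
Proof. exact: change_refl. Qed.

Lemma smooth_curve_near_chart (al : R -> M) s : smooth_curve_at al s ->
  \forall t \near s, cdom (chart_at (al s)) (al t).
Proof. by move=> [cal _]; apply: cal; apply: near_cdom; exact: in_chart_at. Qed.

Lemma smooth_curve_derivable (al : R -> M) s : smooth_curve_at al s ->
  derivable (fun t => coord (al s) (al t)) s 1.
Proof. by move=> [_ h]; exact: smooth_at_derivable. Qed.

(** The velocity field read in the fixed chart at [p] is the derivative of the
    coordinates of the curve. *)
Lemma velocity_change (al : R -> M) p t : smooth_curve_at al t ->
  cdom (chart_at p) (al t) ->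
  velocity al t *m change (al t) p (coord (al t) (al t)) =
    'D_1 (fun r => coord p (al r)) t.
Proof.
move=> st pt; have tt := in_chart_at (al t).
have dt := transition_differentiable tt pt.
have /derivable1_diffP dc := smooth_curve_derivable st.
rewrite /velocity derive1E /change -(deriveEjacobian _ dt) -(derive_comp _ dc dt).
apply: near_eq_derive; have := smooth_curve_near_chart st.
by apply: filterS => r tr; rewrite /= /transition coordK.
Qed.

End ChartChange.

(** * The Hessian *)

Lemma bilinear_formE (R : comNzRingType) n (A : 'M[R]_n) (v w : 'rV[R]_n) :
  (v *m A *m w^T) 0 0 = \sum_i \sum_j v 0 i * A i j * w 0 j.
Proof.
rewrite mxE exchange_big/=; apply: eq_bigr => j _.
by rewrite !mxE mulr_suml.
Qed.

(** Polarization. *)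
Lemma symmetric_form_eq0 (R : numFieldType) n (A : 'M[R]_n) : A^T = A ->
  (forall v : 'rV[R]_n, (v *m A *m v^T) 0 0 = 0) -> A = 0.
Proof.
move=> symA A0; apply/matrixP => i j; rewrite [RHS]mxE.
pose e k : 'rV[R]_n := delta_mx 0 k.
have eAe k l : (e k *m A *m (e l)^T) 0 0 = A k l.
  by rewrite -rowE trmx_delta -colE !mxE.
have := A0 (e i + e j).
rewrite linearD/= mulmxDl mulmxDr !mulmxDl ![fun_of_matrix (_ + _) 0 0]mxE !eAe.
have diag k : A k k = 0 by rewrite -eAe A0.
have -> : A j i = A i j by rewrite -[in LHS]symA mxE.
rewrite !diag addr0 add0r -mulr2n => /eqP.
by rewrite mulrn_eq0/= => /eqP.
Qed.

Lemma derive_affine_line (R : realType) (a b t : R) :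
  'D_1 (fun u : R => a * u + b) t = a.
Proof.
have -> : (fun u : R => a * u + b) = cst a * id + cst b by [].
by rewrite derive_val scaler0 !addr0 [_ *: _]mulr1.
Qed.

Section Hessian.
Variables (R : realType) (n : nat) (M : riemannianManifold R n).
Variables (f : M -> R) (f_smooth : smooth_fun f).
Implicit Types (p : M) (al : R -> M).

Let phi p := f \o point_of p.
Let d p := partials (phi p) (coord p p).

(** The components of the covariant derivative of the differential of [f], at
    the centre of the chart at [p]. *)
Definition hessian p : 'M[R]_n :=
  second_partials (phi p) (coord p p) -
  \matrix_(i, j) \sum_k christoffel p (coord p p) k i j * d p k 0.

Let phiC p : exists2 U, open_nbhs (coord p p) U & forall k, Ck k U (phi p).
Proof. exact: f_smooth. Qed.

Let phi_near p : \forall x \near coord p p, differentiable (phi p) x /\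
  forall u, 'D_u (phi p) x = covector (partials (phi p) x) u.
Proof.
have [U [oU Up] CU] := phiC p.
have : \forall x \near coord p p, U x by exact: open_nbhs_nbhs.
by apply: filterS => x Ux; exact: C1_differentiable_fun oU Ux (CU 1%N).
Qed.

Lemma dfunE p X : dfun f p X = covector (d p) X.
Proof. exact: (nbhs_singleton (phi_near p)).2. Qed.

Lemma near_dfun_along al (W : R -> 'rV[R]_n) s : smooth_curve_at al s ->
  \forall t \near s, dfun f (al t) (W t) =
    covector (partials (phi (al s)) (coord (al s) (al t))) (field_rep al W s t).
Proof.
move=> sal; have ss := in_chart_at (al s).
have cc : {for s, continuous (fun t => coord (al s) (al t))}.
  by apply: continuous_comp; [exact: sal.1|exact: coord_continuous_at].
have near1 : \forall t \near s, differentiable (phi (al s)) (coord (al s) (al t))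
   /\ forall u, 'D_u (phi (al s)) (coord (al s) (al t)) =
      covector (partials (phi (al s)) (coord (al s) (al t))) u.
  exact: cc _ (phi_near (al s)).
apply: filterS2 near1 (smooth_curve_near_chart sal) => t [df dE] pt.
by rewrite (dfun_change _ pt df) dE.
Qed.

(* the Christoffel terms of DW/ds and of the Hessian are the same sum *)
Let christoffel_contract p (D : 'cV[R]_n) (v w : 'rV[R]_n) :
  covector D (\row_k \sum_i \sum_j
    christoffel p (coord p p) k i j * v 0 i * w 0 j) =
  (v *m (\matrix_(i, j) \sum_k christoffel p (coord p p) k i j * D k 0)
     *m w^T) 0 0.
Proof.
rewrite covectorE bilinear_formE.
under eq_bigr do rewrite mxE mulr_suml.
rewrite exchange_big/=; apply: eq_bigr => i _.
under eq_bigr do rewrite mulr_suml.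
rewrite exchange_big/=; apply: eq_bigr => j _.
rewrite mxE mulr_sumr mulr_suml; apply: eq_bigr => k _.
by ring.
Qed.

(** Near [s] everything is read in the chart at [al s].  The Christoffel terms
    of the covariant derivative of [W] and of the Hessian cancel. *)
Lemma derive_dfun_along al (W : R -> 'rV[R]_n) s :
  smooth_curve_at al s -> derivable (field_rep al W s) s 1 ->
  let c t := dfun f (al t) (W t) in
  derivable c s 1 /\
  'D_1 c s = dfun f (al s) (covD al W s) +
    (velocity al s *m hessian (al s) *m (W s)^T) 0 0.
Proof.
move=> sal dW c; have [U [oU Us] CU] := phiC (al s).
have [dc dE] := derive_partials_along oU Us (CU 2%N) (smooth_curve_derivable sal) dW.
have nc := near_dfun_along W sal.
have nc' : \forall t \near s, covector (partials (phi (al s)) (coord (al s) (al t)))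
    (field_rep al W s t) = c t by apply: filterS nc => t E; exact: esym E.
split; first exact: near_eq_derivable nc' dc.
rewrite -(near_eq_derive _ nc') dE field_rep_refl dfunE /covD covectorD -!derive1E.
rewrite christoffel_contract /hessian mulmxBr mulmxBl.
rewrite [fun_of_matrix (_ - _) 0 0]mxE [fun_of_matrix (- _) 0 0]mxE.
rewrite -/(d (al s)) -/(velocity al s).
have cancel_mid (x a b : R) : x + a = x + b + (a - b) by ring.
exact: cancel_mid.
Qed.

Lemma gram_sym p x : (gram p x)^T = gram p x.
Proof.
have [_ _ _ h _] := rdataP M.
by rewrite /gram !trmx_mul trmxK (h _).1 mulmxA.
Qed.

Lemma christoffel_sym p x k i j : christoffel p x k i j = christoffel p x k j i.
Proof.
rewrite /christoffel; congr (_ * _); apply: eq_bigr => l _; congr (_ * _).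
have -> : (fun y => gram p y i j) = (fun y => gram p y j i).
  by apply/funext => y; rewrite -[in LHS]gram_sym mxE.
by rewrite [X in X - _]addrC.
Qed.

(** Schwarz's theorem, and the absence of torsion of the Levi-Civita connection. *)
Lemma hessian_sym p : (hessian p)^T = hessian p.
Proof.
have [U [oU Up] CU] := phiC p.
rewrite /hessian raddfB/=; congr (_ - _).
  apply/matrixP => i j; rewrite [LHS]mxE [LHS]mxE [RHS]mxE.
  exact: derive_swap oU Up (CU 2%N).
apply/matrixP => i j; rewrite [LHS]mxE [LHS]mxE [RHS]mxE.
by apply: eq_bigr => k _; rewrite christoffel_sym.
Qed.

Lemma derive_along_velocity al t : smooth_curve_at al t ->
  'D_1 (f \o al) t = dfun f (al t) (velocity al t).
Proof.
move=> st; have dphi := (nbhs_singleton (phi_near (al t))).1.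
have /derivable1_diffP dc := smooth_curve_derivable st.
rewrite /dfun /velocity derive1E -(derive_comp _ dc dphi).
apply: near_eq_derive; have := smooth_curve_near_chart st.
by apply: filterS => r tr; rewrite /phi /= coordK.
Qed.

Lemma velocity_field_derivable al s : (forall t, smooth_curve_at al t) ->
  derivable (field_rep al (velocity al) s) s 1.
Proof.
move=> sal; have dv : derivable ('D_1 (fun r => coord (al s) (al r))) s 1.
  by apply: smooth_at_derivable; apply: smooth_at_derive; exact: (sal s).2.
apply: near_eq_derivable dv; have := smooth_curve_near_chart (sal s).
by apply: filterS => t pt; rewrite /field_rep velocity_change.
Qed.

Hypotheses (M_complete : complete_riem M) (f_affine : affine_fun f).

(** Along the geodesic of initial velocity [v], [df (ga')] is the slope of the
    affine function [f \o ga], hence constant, and [D ga' / dt = 0]. *)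
Lemma affine_hessian0 p : hessian p = 0.
Proof.
apply: symmetric_form_eq0 (hessian_sym p) _ => v.
have [ga [geo ga0 gav]] := M_complete p v.
have [|a [b fE]] := @f_affine setT ga _ geo; first by [].
have sga t : smooth_curve_at ga t by have [] := geo t I.
have cst_dfun : (fun t => dfun f (ga t) (velocity ga t)) = cst a.
  apply/funext => t; rewrite -derive_along_velocity//.
  have -> : f \o ga = (fun t => a * t + b).
    by apply/funext => r; rewrite /= fE.
  exact: derive_affine_line.
have [_] := derive_dfun_along (sga 0) (velocity_field_derivable sga).
rewrite cst_dfun derive_cst (geo 0 I).2 dfunE covectorE big1 ?add0r; last first.
  by move=> i _; rewrite mxE mul0r.
by rewrite ga0 gav.
Qed.

Lemma affine_derive_dfun_along al (W : R -> 'rV[R]_n) s :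
  smooth_curve_at al s -> smooth_field_at al W s ->
  let c t := dfun f (al t) (W t) in
  derivable c s 1 /\ 'D_1 c s = dfun f (al s) (covD al W s).
Proof.
move=> sal sW c.
have [dc ->] := derive_dfun_along sal (smooth_at_derivable sW).
by rewrite affine_hessian0 mulmx0 mul0mx mxE addr0.
Qed.

End Hessian.

(** * The gradient in an orthonormal frame *)

Section Frames.
Variables (R : realType) (n : nat) (M : riemannianManifold R n).
Implicit Types p : M.

Lemma metric_unit p : metric p \in unitmx.
Proof.
have [_ _ _ /(_ p)[_ pos] _] := rdataP M.
rewrite -row_free_unit -kermx_eq0; apply/rowV0P => u /sub_kermxP ug0.
by have [//|/pos] := eqVneq u 0; rewrite /inner ug0 mul0mx mxE ltxx.
Qed.

Lemma inner_grad (f : M -> R) p X : smooth_fun f ->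
  inner p (grad f p) X = dfun f p X.
Proof.
move=> fs; suff ex : exists G, [set G | forall X, dfun f p X = inner p G X] G.
  by rewrite -(getPex ex).
exists ((partials (f \o point_of p) (coord p p))^T *m invmx (metric p)) => Y.
rewrite (dfunE fs) /inner mulmxKV ?metric_unit// -trmx_mul mxE.
by [].
Qed.

(** With [A] the matrix of the frame and [g] that of the metric, [A g A^T = 1],
    so [g A^T] is a left inverse of [A] as well and
    [G g G^T = (G g A^T) (G g A^T)^T]. *)
Lemma orthonormal_expansion p (E : 'I_n -> 'rV[R]_n) (G : 'rV[R]_n) :
  (forall i j, inner p (E i) (E j) = (i == j)%:R) ->
  inner p G G = \sum_i inner p G (E i) ^+ 2.
Proof.
move=> onE; pose A := \matrix_i E i; set g := metric p.
have [_ _ _ /(_ p)[symg _] _] := rdataP M.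
have innerE (u : 'rV[R]_n) i : inner p u (E i) = (u *m (g *m A^T)) 0 i.
  rewrite /inner mulmxA !mxE; apply: eq_bigr => j _; congr (_ * _).
  by rewrite !mxE.
have AgA : A *m (g *m A^T) = 1%:M.
  apply/matrixP => i j; rewrite [RHS]mxE -onE innerE -(rowK E i).
  by rewrite -row_mul [RHS]mxE.
have -> : inner p G G = ((G *m (g *m A^T)) *m (G *m (g *m A^T))^T) 0 0.
  rewrite {1}/inner -/g !trmx_mul trmxK symg.
  rewrite -[in LHS](mul1mx g) -(mulmx1C AgA) !mulmxA.
  by [].
by rewrite mxE; apply: eq_bigr => i _; rewrite innerE expr2 [_^T _ _]mxE.
Qed.

End Frames.

(** * The Frenet equations and the harmonic curvatures *)

Section FrenetRecursion.
Variables (R : realType) (n : nat) (hn : (3 <= n)%N).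
Variables (I : set R) (I_interval : is_interval I).
Hypothesis I_nondegenerate : exists a b : R, [/\ I a, I b & a < b].
Variables (k c : nat -> R -> R).
Hypothesis k_smooth : forall i s, (1 <= i <= n.-1)%N -> I s -> smooth_at (k i) s.
Hypothesis k_gt0 : forall i s, (1 <= i <= n.-1)%N -> I s -> 0 < k i s.
Hypothesis c_derivable : forall i s, (1 <= i <= n)%N -> I s -> derivable (c i) s 1.
Hypothesis c_frenet : forall i s, (1 <= i <= n)%N -> I s ->
  'D_1 (c i) s = - k i.-1 s * c i.-1 s + k i s * c i.+1 s.
Hypothesis c0 : forall s, c 0%N s = 0.
Hypothesis cn1 : forall s, c n.+1 s = 0.
Variable a : R.
Hypothesis cn : forall s, I s -> c n s = a.

(** [g] is a formula for [c m] that is only known on [I]; it may nevertheless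
    replace [c m] under the derivative of the Frenet equation. *)
Lemma frenet_step m (g : R -> R) s : (1 <= m <= n)%N -> I s ->
  derivable g s 1 -> (forall t, I t -> c m t = g t) ->
  k m.-1 s * c m.-1 s = k m s * c m.+1 s - 'D_1 g s.
Proof.
move=> mn Is dg cg.
have <- : 'D_1 (c m) s = 'D_1 g s.
  exact: derive_eq_on_interval (c_derivable mn Is) dg cg.
by rewrite c_frenet//; ring.
Qed.

Lemma Hstar_smooth i s : (i <= n - 2)%N -> I s -> smooth_at (Hstar n k i) s.
Proof.
move=> + Is; suff H : ((i <= n - 2)%N -> smooth_at (Hstar n k i) s) /\
   ((i.+1 <= n - 2)%N -> smooth_at (Hstar n k i.+1) s) by case: H.
elim: i => [|i [IH1 IH2]]; split.
- by move=> _; exact: smooth_at_cst.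
- move=> n2; apply: smooth_atM; first by apply: k_smooth => //; lia.
  apply: smooth_atV; last by apply: k_smooth => //; lia.
  by rewrite gt_eqF// k_gt0//; lia.
- exact: IH2.
move=> n3; apply: smooth_atM; last first.
  apply: smooth_atV; last by apply: k_smooth => //; lia.
  by rewrite gt_eqF// k_gt0//; lia.
apply: smooth_atB.
  apply: smooth_atM; last by apply: IH1; lia.
  by apply: k_smooth => //; lia.
have -> : derive1 (Hstar n k i.+1) = 'D_1 (Hstar n k i.+1).
  by apply/funext => t; rewrite derive1E.
by apply/smooth_at_derive/IH2; lia.
Qed.

(** Downwards from [c n = a] and [c n.+1 = 0]: at each step [frenet_step] is the
    recursion of [Hstar], which has order two. *)
Lemma coef_Hstar i s : (i <= n - 2)%N -> I s ->
  c (n - 1 - i)%N s = a * Hstar n k i s.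
Proof.
suff H : (forall s, (i <= n - 2)%N -> I s -> c (n - 1 - i)%N s = a * Hstar n k i s) /\
  (forall s, (i.+1 <= n - 2)%N -> I s ->
    c (n - 1 - i.+1)%N s = a * Hstar n k i.+1 s) by case: H => + _; apply.
have cn' t : I t -> c n.-1 t = 0.
  move=> It; apply/eqP; have kt : k n.-1 t != 0 by rewrite gt_eqF// k_gt0//; lia.
  have := @frenet_step n (cst a) t _ It (derivable_cst _ _ _) cn.
  rewrite derive_cst cn1 mulr0 subr0 => /(_ _)/eqP.
  by rewrite mulf_eq0 (negPf kt); apply; lia.
elim: i => [|i [IH1 IH2]]; split.
- by move=> t _ It; rewrite subn0 subn1 cn' ?mulr0.
- move=> t n2 It; have kt : k (n - 2)%N t != 0 by rewrite gt_eqF// k_gt0//; lia.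
  have h := @frenet_step n.-1 (cst 0) t _ It (derivable_cst _ _ _) cn'.
  rewrite derive_cst subr0 in h.
  apply: (mulfI kt); rewrite /=.
  have -> : (n - 1 - 1 = n.-1.-1)%N by lia.
  have -> : (n - 2 = n.-1.-1)%N by lia.
  have kt' : k n.-1.-1 t != 0 by rewrite gt_eqF// k_gt0//; lia.
  rewrite h; last lia.
  rewrite (ltn_predK hn) cn// subn1; field.
  exact: kt'.
- exact: IH2.
move=> t n3 It.
have n2 : (i.+1 <= n - 2)%N by lia.
have dH : derivable (Hstar n k i.+1) t 1.
  exact: smooth_at_derivable (Hstar_smooth n2 It).
have daH : derivable (fun s => a * Hstar n k i.+1 s) t 1.
  exact: derivableM (derivable_cst _ _ _) dH.
have mn : (1 <= n - i.+2 <= n)%N by lia.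
have e2 : (n - 1 - i.+1 = n - i.+2)%N by lia.
have IH2' r : I r -> c (n - i.+2)%N r = a * Hstar n k i.+1 r.
  by move=> Ir; rewrite -e2; exact: IH2.
have := frenet_step mn It daH IH2'.
have -> : (n - i.+2).-1 = (n - i.+3)%N by lia.
have -> : (n - i.+2).+1 = (n - 1 - i)%N by lia.
have -> : (n - 1 - i.+2 = n - i.+3)%N by lia.
rewrite IH1//; last lia.
rewrite (deriveMl a dH) -derive1E => h.
have kt : k (n - i.+3)%N t != 0 by rewrite gt_eqF// k_gt0//; lia.
apply: (mulfI kt); rewrite h.
rewrite -[Hstar n k i.+2 t]/((k (n - i.+2)%N t * Hstar n k i t -
  derive1 (Hstar n k i.+1) t) / k (n - i.+3)%N t).
by field.
Qed.

(** [c 1 = a * Hstar n k (n - 2)]; from [c 0 = c 1 = 0] the Frenet equations give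
    [c m = 0] for all [m], against [c n = a]. *)
Lemma Hstar_last_neq0 : a != 0 -> exists2 s, I s & Hstar n k (n - 2) s != 0.
Proof.
move=> a_neq0; have [s0 [_ [Is0 _ _]]] := I_nondegenerate.
apply: contrapT => noH.
have H0 s : I s -> Hstar n k (n - 2) s = 0.
  by move=> Is; apply: contrapT => /eqP Hs; apply: noH; exists s.
have c1 s : I s -> c 1%N s = 0.
  move=> Is; have := coef_Hstar (leqnn _) Is.
  by rewrite H0// mulr0; have -> : (n - 1 - (n - 2) = 1)%N by lia.
suff all0 m : (m.+1 <= n)%N -> forall s, I s -> c m.+1 s = 0 /\ c m s = 0.
  move: a_neq0; rewrite -(cn Is0).
  have := all0 n.-1; rewrite (ltn_predK hn) => /(_ (leqnn _) _ Is0)[-> _].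
  by rewrite eqxx.
elim: m => [|m IH] mn s Is; first by split; [exact: c1|exact: c0].
have IH' := IH (ltnW mn).
split; last exact: (IH' s Is).1.
have km : k m.+1 s != 0 by rewrite gt_eqF// k_gt0//; lia.
have := @frenet_step m.+1 (cst 0) s (ltnW mn) Is (derivable_cst _ _ _)
  (fun t It => (IH' t It).1).
rewrite derive_cst subr0 /= (IH' s Is).2 mulr0 => /esym/eqP.
by rewrite mulf_eq0 (negPf km) => /eqP.
Qed.

(** The term 1 comes from [c n = a]; [c n.-1] contributes nothing because
    [Hstar n k 0 = 0]. *)
Lemma sum_coef s : I s ->
  \sum_(i < n) c i.+1 s ^+ 2 =
  a ^+ 2 * (1 + \sum_(1 <= i < n.-1) Hstar n k i s ^+ 2).
Proof.
move=> Is; rewrite -(big_mkord xpredT (fun i => c i.+1 s ^+ 2)) big_nat_rev/= add0n.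
rewrite -(ltn_predK hn) big_nat_recl//= subn1 /= (ltn_predK hn) cn// mulrDr mulr1.
congr (_ + _); rewrite big_distrr/=.
rewrite big_ltn; last lia.
have coefE i : (i <= n - 2)%N -> c (n - i.+2).+1 s = a * Hstar n k i s.
  by move=> ni; rewrite -coef_Hstar//; congr (c _ s); lia.
rewrite coefE// mulr0 expr0n add0r.
by apply: eq_big_nat => i ni; rewrite coefE ?exprMn//; lia.
Qed.

End FrenetRecursion.

Theorem theorem4p3 (R : realType) (n : nat) (hn : (3 <= n)%N)
  (M : riemannianManifold R n)
  (M_connected : connected [set: M]) (M_complete : complete_riem M)
  (N : riemannianManifold R n.-1)
  (M_product : isometric M (riem_prod N (real_line R)))
  (f : M -> R) (f_smooth : smooth_fun f)
  (f_affine : affine_fun f) (f_nontrivial : nontrivial_fun f)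
  (I : set R) (I_interval : is_interval I)
  (I_nondegenerate : exists a b : R, [/\ I a, I b & a < b])
  (al : R -> M) (V : nat -> R -> 'rV[R]_n) (k : nat -> R -> R)
  (al_frenet : frenet_curve I al V k)
  (al_slant : eikonal_Vn_slant f I al V) :
  (exists2 s, I s & Hstar n k (n - 2) s != 0) /\
  (exists2 c : R, c != 0 &
     forall s, I s -> \sum_(1 <= i < n.-1) (Hstar n k i s) ^+ 2 = c).
Proof.
have [V0 [Vn1 fr]] := al_frenet.
have [[C normC] [a a_neq0 slant]] := al_slant.
pose c i t := dfun f (al t) (V i t).
have cE i s : c i s = inner (al s) (grad f (al s)) (V i s).
  by rewrite inner_grad.
have dfun0 p : dfun f p 0 = 0.
  by rewrite -inner_grad// /inner trmx0 mulmx0 mxE.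
have k_smooth i s : (1 <= i <= n.-1)%N -> I s -> smooth_at (k i) s.
  by move=> ni /fr[_ _ _ /(_ i ni)[]].
have k_gt0 i s : (1 <= i <= n.-1)%N -> I s -> 0 < k i s.
  by move=> ni /fr[_ _ _ /(_ i ni)[]].
have dc i s : (1 <= i <= n)%N -> I s ->
    derivable (c i) s 1 /\ 'D_1 (c i) s = dfun f (al s) (covD al (V i) s).
  move=> ni /fr[sal _ /(_ i ni) sV _ _].
  exact: affine_derive_dfun_along.
have c_frenet i s : (1 <= i <= n)%N -> I s ->
    'D_1 (c i) s = - k i.-1 s * c i.-1 s + k i s * c i.+1 s.
  move=> ni Is; have [_ _ _ _ [_ /(_ i ni) covE]] := fr s Is.
  by rewrite (dc i s ni Is).2 covE /c !(dfunE f_smooth) covectorD !covectorZ.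
have c0 s : c 0%N s = 0 by rewrite /c V0 dfun0.
have cn1 s : c n.+1 s = 0 by rewrite /c Vn1 dfun0.
have cn s : I s -> c n s = a by move=> Is; rewrite cE slant.
have sumE s : I s ->
    \sum_(1 <= i < n.-1) (Hstar n k i s) ^+ 2 = C ^+ 2 / a ^+ 2 - 1.
  move=> Is; have a2 : a ^+ 2 != 0 by rewrite expf_neq0.
  have [_ _ _ _ [onV _]] := fr s Is.
  have normE : C ^+ 2 = a ^+ 2 * (1 + \sum_(1 <= i < n.-1) (Hstar n k i s) ^+ 2).
    rewrite -(sum_coef hn I_interval I_nondegenerate k_smooth k_gt0
      (fun i s ni Is => (dc i s ni Is).1) c_frenet cn1 cn Is).
    have expand := @orthonormal_expansion R n M (al s) (fun i => V i.+1 s)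
      (grad f (al s)).
    rewrite -(normC _ Is) /tnorm sqr_sqrtr.
      rewrite expand; first by apply: eq_bigr => i _; rewrite cE.
      by move=> i j; rewrite onV ?ltn_ord.
    rewrite expand; first by apply: sumr_ge0 => i _; exact: sqr_ge0.
    by move=> i j; rewrite onV ?ltn_ord.
  by rewrite normE mulrAC divff// mul1r addrAC subrr add0r.
split.
  exact: (Hstar_last_neq0 hn I_interval I_nondegenerate k_smooth k_gt0
    (fun i s ni Is => (dc i s ni Is).1) c_frenet c0 cn1 cn a_neq0).
exists (C ^+ 2 / a ^+ 2 - 1) => //.
have [s [_ [Is _ _]]] := I_nondegenerate.
rewrite -(sumE s Is) gt_eqF// big_ltn; last lia.
rewrite ltr_wpDr//; first by apply: sumr_ge0 => i _; exact: sqr_ge0.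
by rewrite exprn_gt0//= divr_gt0// k_gt0//; lia.
Qed.
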